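(* Let $\Omega\subset\mathbb{R}^d$ be open and bounded, let $X$ be a real Banach space and let $f\in C(\partial\Omega,X)$. For $\xi\in\Omega$ let $\mu_\xi$ be the harmonic measure of $\Omega$ at $\xi$. Then the Perron solution $H_f$ is given by $$H_f(\xi)=\int_{\partial\Omega}f\,d\mu_\xi\qquad\text{for all }\xi\in\Omega .$$
   Context: A function $u:\Omega\to X$ is harmonic if $u\in C^2(\Omega,X)$ and $\Delta u=0$. $\partial_{\mathrm{reg}}\Omega$ is the set of regular boundary points in the sense of Wiener: $z\in\partial\Omega$ is regular iff $\Omega^c$ is not thin at $z$; equivalently, iff for every $g\in C(\partial\Omega,\mathbb{R})$ the classical real-valued Perron solution $h_g$ (the pointwise supremum of all $w\in C(\overline\Omega,\mathbb{R})$ that are subharmonic in $\Omega$ with $w\le g$ on $\partial\Omega$) satisfies $\lim_{\xi\to z}h_g(\xi)=g(z)$. For $f\in C(\partial\Omega,X)$, the Perron solution $H_f$ is the unique bounded harmonic function $\Omega\to X$ with $\lim_{\xi\to z}H_f(\xi)=f(z)$ for all $z\in\partial_{\mathrm{reg}}\Omega$. For $\xi\in\Omega$ the map $C(\partial\Omega,\mathbb{R})\to\mathbb{R}$, $g\mapsto H_g(\xi)$ is linear and positive; the harmonic measure $\mu_\xi$ is the unique Borel probability measure on $\partial\Omega$, given by the Riesz Representation Theorem, with $H_g(\xi)=\int_{\partial\Omega}g\,d\mu_\xi$ for all $g\in C(\partial\Omega,\mathbb{R})$. The integral of the $X$-valued continuous function $f$ is a Bochner integral. *)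

(* Defs.v *)
From HB Require Import structures.
From mathcomp Require Import all_boot all_order all_algebra.
From mathcomp Require Import all_classical all_reals all_analysis.

Set Implicit Arguments.
Unset Strict Implicit.
Unset Printing Implicit Defensive.

Import Order.TTheory GRing.Theory Num.Theory.
Import numFieldNormedType.Exports.
Local Open Scope classical_set_scope.
Local Open Scope ring_scope.

(* Functions on Omega, its closure or its boundary are represented by total
   functions on R^d whose values elsewhere are never used. The norm of the
   library on 'rV[R]_d is the sup norm; the topology and the bounded sets are
   the Euclidean ones. Where Euclidean balls matter they are written out. *)

Section Harmonic.
Context {R : realType} {d : nat}.
Implicit Types (X : normedModType R) (Omega : set 'rV[R]_d).

Definition boundary Omega : set 'rV[R]_d := closure Omega `\` interior Omega.

Definition unit_vec (i : 'I_d) : 'rV[R]_d := delta_mx 0 i.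

(* For open Omega, in terms of partial derivatives. *)
Definition C1_on X Omega (u : 'rV[R]_d -> X) : Prop :=
  forall x, Omega x ->
    {for x, continuous u} /\
    forall i, derivable u x (unit_vec i) /\
              {for x, continuous ('D_(unit_vec i) u)}.

Definition C2_on X Omega (u : 'rV[R]_d -> X) : Prop :=
  C1_on Omega u /\ forall i, C1_on Omega ('D_(unit_vec i) u).

Definition laplacian X (u : 'rV[R]_d -> X) (x : 'rV[R]_d) : X :=
  \sum_(i < d) 'D_(unit_vec i) ('D_(unit_vec i) u) x.

Definition harmonic_on X Omega (u : 'rV[R]_d -> X) : Prop :=
  C2_on Omega u /\ forall x, Omega x -> laplacian u x = 0.

Definition sqdist (a x : 'rV[R]_d) : R := \sum_(i < d) (x 0 i - a 0 i) ^+ 2.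

(* Subharmonicity of a continuous function: it lies below every harmonic
   function on a closed Euclidean ball inside Omega that dominates it on the
   sphere. *)
Definition subharmonic_on Omega (w : 'rV[R]_d -> R) : Prop :=
  forall (a : 'rV[R]_d) (r : R), 0 < r ->
    [set x | sqdist a x <= r ^+ 2] `<=` Omega ->
    forall h : 'rV[R]_d -> R,
      {within [set x | sqdist a x <= r ^+ 2], continuous h} ->
      harmonic_on (X := R^o) [set x | sqdist a x < r ^+ 2] h ->
      (forall x, sqdist a x = r ^+ 2 -> w x <= h x) ->
      forall x, sqdist a x < r ^+ 2 -> w x <= h x.

Definition perron_subsolution Omega (g w : 'rV[R]_d -> R) : Prop :=
  [/\ {within closure Omega, continuous w},
      subharmonic_on Omega w &
      forall z, boundary Omega z -> w z <= g z].

Definition classical_perron Omega (g : 'rV[R]_d -> R) (xi : 'rV[R]_d) : R :=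
  sup [set w xi | w in perron_subsolution Omega g].

Definition regular_boundary Omega : set 'rV[R]_d :=
  [set z | boundary Omega z /\
     forall g : 'rV[R]_d -> R, {within boundary Omega, continuous g} ->
       classical_perron Omega g @ within Omega (nbhs z) --> g z].

Definition bounded_dirichlet_solution X Omega (f u : 'rV[R]_d -> X) : Prop :=
  [/\ harmonic_on Omega u,
      [bounded u x | x in Omega] &
      forall z, regular_boundary Omega z ->
        u @ within Omega (nbhs z) --> f z].

(* "H is the unique bounded harmonic function with these boundary limits";
   uniqueness is as a function on Omega. *)
Definition is_perron_solution X Omega (f H : 'rV[R]_d -> X) : Prop :=
  bounded_dirichlet_solution Omega f H /\
  forall u, bounded_dirichlet_solution Omega f u ->
    forall xi, Omega xi -> u xi = H xi.

End Harmonic.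

Section Bochner.
Context {d : measure_display} {T : measurableType d} {R : realType}.
Context (mu : {finite_measure set T -> \bar R}) (D : set T).
Context {X : normedModType R}.
Local Open Scope ereal_scope.

Definition bochner_simple (s : T -> X) : Prop :=
  finite_set (s @` D) /\ forall y, measurable (D `&` s @^-1` [set y]).

Definition bochner_sintegral (s : T -> X) : X :=
  (\sum_(y \in s @` D) fine (mu (D `&` s @^-1` [set y])) *: y)%R.

Definition is_bochner_integral (f : T -> X) (I : X) : Prop :=
  exists s : nat -> T -> X,
    [/\ forall n, bochner_simple (s n),
        {ae mu, forall x, D x -> s n x @[n --> \oo] --> f x},
        \int[mu]_(x in D) (`|f x - s n x|%R)%:E @[n --> \oo] --> 0 &
        bochner_sintegral (s n) @[n --> \oo] --> I].

Definition bochner_integrable (f : T -> X) : Prop :=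
  exists I, is_bochner_integral f I.

Definition bochner_integral (f : T -> X) : X :=
  xget 0%R [set I | is_bochner_integral f I].

End Bochner.

(* R^d with its Borel sigma-algebra. *)
Definition borelRn (R : realType) (d : nat) :=
  g_sigma_algebraType (@open 'rV[R]_d).

(* A Borel probability measure on the boundary is represented by a Borel
   probability measure on R^d giving full mass to the boundary (a closed set).
   H_g denotes the unique real-valued Perron solution, whose existence is part
   of the requirement. *)
Definition is_harmonic_measure (R : realType) (d : nat)
    (Omega : set 'rV[R]_d) (xi : 'rV[R]_d)
    (mu : probability (borelRn R d) R) : Prop :=
  mu (boundary Omega) = 1%E /\
  forall g : 'rV[R]_d -> R, {within boundary Omega, continuous g} ->
    exists Hg : 'rV[R]_d -> R,
      is_perron_solution (X := R^o) Omega g Hg /\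
      Hg xi = (\int[mu]_(z in boundary Omega) g z)%R.

(* Main.v *)
(** A linear contraction [phi : X -> R] maps the Perron solution of [f] to the
    Perron solution of the real boundary function [phi \o f], since it commutes
    with limits and derivatives. Hence [phi (Hf xi)] is the integral of
    [phi \o f] against the harmonic measure. By Hahn-Banach some [phi] norms
    the difference between [Hf xi] and the integral of a simple function [s],
    so this difference is at most the integral of [`|f - s|]. As [f] is
    uniformly approximated by simple functions on the compact boundary, [f] is
    Bochner integrable with integral [Hf xi]. *)

From HB Require Import structures.
Require Import Defs.
From mathcomp Require Import all_boot all_order all_algebra.
From mathcomp Require Import all_classical all_reals all_analysis.
From mathcomp Require Import finmap measurable_realfun lra.
Set Implicit Arguments.
Unset Strict Implicit.
Unset Printing Implicit Defensive.
Import Order.TTheory GRing.Theory Num.Theory.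
Import numFieldNormedType.Exports.
Local Open Scope classical_set_scope.
Local Open Scope ring_scope.

(** * Hahn-Banach through minimal sublinear functionals *)

Section HahnBanach.
Context {R : realType} {E : lmodType R}.
Implicit Types (p q : E -> R) (a x y : E).

(** An inequality suffices for positive homogeneity: used with the inverse scalar as well, it
    becomes the equality [sublinearZ]. *)
Definition sublinear p :=
  (forall x y, p (x + y) <= p x + p y) /\
  (forall c x, 0 <= c -> p (c *: x) <= c * p x).

Lemma sublinear0 p : sublinear p -> p 0 = 0.
Proof.
move=> [pD pZ]; apply/eqP; rewrite eq_le; apply/andP; split.
  by have := pZ 0 0 (lexx _); rewrite scale0r mul0r.
by have := pD 0 0; rewrite addr0 -subr_ge0 addrK.
Qed.

Lemma sublinearZ p c x : sublinear p -> 0 <= c -> p (c *: x) = c * p x.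
Proof.
move=> sp; rewrite le_eqVlt => /predU1P[<-|c0].
  by rewrite scale0r mul0r sublinear0.
apply/eqP; rewrite eq_le (sp.2 _ _ (ltW c0))/= -ler_pdivlMl//.
have := sp.2 c^-1 (c *: x); rewrite scalerA mulVf ?gt_eqF// scale1r; apply.
by rewrite invr_ge0 ltW.
Qed.

Lemma sublinear_geN p x : sublinear p -> - p (- x) <= p x.
Proof.
move=> sp; have := sp.1 x (- x).
by rewrite subrr sublinear0// -lerBlDr sub0r.
Qed.

(* A sublinear minorant of [q] with [tilt q a (- a) <= - q a]: a minimal [q]
   equals all its tilts, hence is additive. *)
Definition tilt q a x : R :=
  inf [set q (x + t *: a) - t * q a | t in [set t | 0 <= t]].

Lemma tilt_le q a x t : sublinear q -> 0 <= t ->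
  tilt q a x <= q (x + t *: a) - t * q a.
Proof.
move=> sq t0; apply: ge_inf; last by exists t.
(* Lower bound: [s * q a = q (s *: a)] is at most [q (- x) + q (x + s *: a)]. *)
exists (- q (- x)) => _ [s /= s0 <-].
have := sq.1 (- x) (x + s *: a); rewrite addKr sublinearZ//; lra.
Qed.

Lemma tilt_ge q a x m :
  (forall t, 0 <= t -> m <= q (x + t *: a) - t * q a) -> m <= tilt q a x.
Proof.
move=> mq; apply: lb_le_inf.
  by exists (q (x + 0 *: a) - 0 * q a), 0 => /=.
by move=> _ [t t0 <-]; exact: mq.
Qed.

Lemma tilt_le_id q a x : sublinear q -> tilt q a x <= q x.
Proof.
move=> sq; have := tilt_le a x sq (lexx 0).
by rewrite scale0r addr0 mul0r subr0.
Qed.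

(** Parameters [t] for [x] and [s] for [y] combine to [t + s] for [x + y]; a parameter [t] for [x]
    becomes [c * t] for [c *: x]. *)
Lemma sublinear_tilt q a : sublinear q -> sublinear (tilt q a).
Proof.
move=> sq; split=> [x y|c x].
  rewrite -lerBlDr; apply: tilt_ge => t t0; rewrite lerBlDr -lerBlDl.
  apply: tilt_ge => s s0.
  have := tilt_le a (x + y) sq (addr_ge0 t0 s0).
  have := sq.1 (x + t *: a) (y + s *: a).
  rewrite scalerDl addrACA mulrDl; lra.
rewrite le_eqVlt => /predU1P[<-|c0].
  by have := tilt_le_id a 0 sq; rewrite scale0r mul0r (sublinear0 sq).
rewrite -ler_pdivrMl//; apply: tilt_ge => t t0.
rewrite ler_pdivrMl//.
have := tilt_le a (c *: x) sq (mulr_ge0 (ltW c0) t0).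
by rewrite -scalerA -scalerDr (sublinearZ _ sq (ltW c0)) mulrBr mulrA.
Qed.

(** The bound for Zorn's lemma is the pointwise infimum, finite since every member is at least
    [- p (- x)] at [x]. It is subadditive because, of two members used for [x] and [y], the smaller
    one serves for both. *)
Lemma chain_sublinear_inf p (A : set (E -> R)) : A !=set0 ->
  (forall q, A q -> sublinear q /\ forall x, q x <= p x) ->
  (forall q r, A q -> A r ->
    (forall x, q x <= r x) \/ (forall x, r x <= q x)) ->
  exists2 m, sublinear m & forall q, A q -> forall x, m x <= q x.
Proof.
move=> [q0 Aq0] Asub tot; pose m x := inf [set q x | q in A].
have m_le q x : A q -> m x <= q x.
  move=> Aq; apply: ge_inf; last by exists q.
  exists (- p (- x)) => _ [r Ar <-]; have [sr rp] := Asub _ Ar.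
  by apply: le_trans (sublinear_geN x sr); rewrite lerN2.
have m_ge x k : (forall q, A q -> k <= q x) -> k <= m x.
  move=> kq; apply: lb_le_inf; first by exists (q0 x), q0.
  by move=> _ [q Aq <-]; exact: kq.
exists m; last by move=> q Aq x; exact: m_le.
split=> [x y|c x c0].
  rewrite -lerBlDr; apply: (m_ge) => q Aq; rewrite lerBlDr -lerBlDl.
  apply: (m_ge) => r Ar; rewrite lerBlDr.
  have [qr|rq] := tot _ _ Aq Ar.
    have := (Asub _ Aq).1.1 x y; have := m_le _ (x + y) Aq; have := qr y; lra.
  have := (Asub _ Ar).1.1 x y; have := m_le _ (x + y) Ar; have := rq x; lra.
move: c0; rewrite le_eqVlt => /predU1P[<-|c0].
  by have := m_le _ 0 Aq0; rewrite scale0r mul0r (sublinear0 (Asub _ Aq0).1).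
rewrite -ler_pdivrMl//; apply: (m_ge) => q Aq.
rewrite ler_pdivrMl// -(sublinearZ _ (Asub _ Aq).1 (ltW c0)).
exact: m_le.
Qed.

Lemma minimal_sublinear p : sublinear p ->
  exists q, [/\ sublinear q, forall x, q x <= p x &
    forall r, sublinear r -> (forall x, r x <= q x) -> r = q].
Proof.
move=> sp; pose T := {q : E -> R | sublinear q /\ forall x, q x <= p x}.
(* The order is reversed, so that a maximal element is a minimal functional. *)
pose ge (q r : T) := `[< forall x, sval r x <= sval q x >].
have [||||[q [sq qp]] qmin] := @Zorn T ge.
- by move=> q; apply/asboolP.
- move=> q r s /asboolP qr /asboolP rs; apply/asboolP => x.
  exact: le_trans (rs x) (qr x).
- move=> [q Pq] [r Pr] /asboolP qr /asboolP rq; apply: eq_exist.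
  by apply/funext => x; apply/eqP; rewrite eq_le rq qr.
- move=> A totA; have [[q0 Aq0]|A0] := pselect (A !=set0); last first.
    (* The empty chain is bounded by [p] itself. *)
    have Pp : sublinear p /\ forall x, p x <= p x by [].
    by exists (exist _ p Pp) => q Aq; case: A0; exists q.
  have [||q r|m sm mA] := @chain_sublinear_inf p [set sval q | q in A].
  + by exists (sval q0), q0.
  + by move=> _ [q _ <-]; exact: svalP q.
  + move=> [q' Aq' <-] [r' Ar' <-].
    by have [/asboolP|/asboolP] := totA _ _ Aq' Ar'; [right|left].
  have Pm : sublinear m /\ forall x, m x <= p x.
    split=> // x; apply: (le_trans (mA (sval q0) _ x)); first by exists q0.
    by have [_] := svalP q0; apply.
  exists (exist _ m Pm) => q Aq; apply/asboolP => x /=.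
  by apply: mA; exists q.
exists q; split=> // r sr rq.
have Pr : sublinear r /\ forall x, r x <= p x.
  by split=> // x; exact: le_trans (rq x) (qp x).
by have /(congr1 sval) := qmin (exist _ r Pr) (asboolT rq).
Qed.

Lemma minimal_sublinear_linear q : sublinear q ->
  (forall r, sublinear r -> (forall x, r x <= q x) -> r = q) ->
  linear (q : E -> R^o).
Proof.
move=> sq qmin; have qD x y : q (x + y) = q x + q y.
  apply/eqP; rewrite eq_le sq.1/=.
  (* By minimality [tilt q y = q]; the parameter 1 in the infimum then gives
     [q x <= q (x + y) - q y]. *)
  have /(congr1 (@^~ x)) :=
    qmin _ (sublinear_tilt y sq) (fun x => tilt_le_id y x sq).
  have := tilt_le y x sq ler01; rewrite scale1r mul1r; lra.
have qN x : q (- x) = - q x.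
  by apply/eqP; rewrite -addr_eq0 -qD addNr sublinear0.
move=> c x y; rewrite qD; congr (_ + _).
have [c0|c0] := leP 0 c; first exact: sublinearZ.
rewrite -[c]opprK scaleNr qN (sublinearZ _ sq); last by rewrite oppr_ge0 ltW.
by rewrite scaleNr.
Qed.

(** Minimizing below [tilt p a] instead of [p] forces [phi (- a) <= - p a], which is the missing
    half of equality at [a]. *)
Lemma sublinear_support p a : sublinear p ->
  exists phi : {linear E -> R^o}, (forall x, phi x <= p x) /\ phi a = p a.
Proof.
move=> sp; have st := sublinear_tilt a sp.
have [q [sq qp qmin]] := minimal_sublinear st.
pose phi := HB.pack_for {linear E -> R^o} (q : E -> R^o)
  (GRing.isLinear.Build _ _ _ _ _ (minimal_sublinear_linear sq qmin)).
have phip x : phi x <= p x by exact: le_trans (qp x) (tilt_le_id a x sp).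
exists phi; split=> //; apply/eqP; rewrite eq_le phip andTb.
rewrite -lerN2 -(linearN phi); apply: le_trans (qp _) _.
have := tilt_le a (- a) sp ler01.
by rewrite scale1r addNr mul1r sublinear0// sub0r.
Qed.

End HahnBanach.

Lemma norming_functional {R : realType} {X : normedModType R} (a : X) :
  exists phi : {linear X -> R^o},
    (forall x, `|phi x| <= `|x|) /\ phi a = `|a|.
Proof.
have sn : @sublinear R X (fun x => `|x|).
  split=> [x y|c x c0]; first exact: ler_normD.
  by rewrite normrZ ger0_norm.
have [phi [phin phia]] := sublinear_support a sn.
exists phi; split=> // x; rewrite ler_norml phin andbT.
by rewrite lerNl -linearN -normrN.
Qed.

(** * Continuous linear maps preserve harmonicity and boundary limits *)

Lemma derivable_linear_comp {R : realType} {V W Z : normedModType R}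
    {phi : {linear W -> Z}} {u : V -> W} {x v : V} : continuous phi ->
  derivable u x v ->
  derivable (phi \o u) x v /\ 'D_v (phi \o u) x = phi ('D_v u x).
Proof.
move=> cphi du.
pose quot h := h^-1 *: ((phi \o u \o shift x) (h *: v) - (phi \o u) x).
have cvg_phi : quot @ (0 : R)^' --> phi ('D_v u x).
  have -> : quot = phi \o (fun h => h^-1 *: ((u \o shift x) (h *: v) - u x)).
    by apply/funext => h; rewrite /quot /= linearZ_LR (linearB phi).
  exact: (cvg_comp _ _ du (cphi _)).
by split; [apply/cvg_ex; eexists; exact: cvg_phi|apply/cvg_lim => //].
Qed.

Section LinearComp.
Context {R : realType} {d : nat} {X Y : normedModType R}.
Context {phi : {linear X -> Y}} {Omega : set 'rV[R]_d}.
Hypotheses (cphi : continuous phi) (oO : open Omega).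

Lemma near_open_eq {T : Type} (u v : 'rV[R]_d -> T) x : Omega x ->
  (forall y, Omega y -> u y = v y) -> \near x, u x = v x.
Proof. by move=> Ox uv; apply: filterS (open_nbhs_nbhs (conj oO Ox)). Qed.

Lemma eq_near_continuous {V W : topologicalType} (u v : V -> W) x :
  (\near x, u x = v x) -> {for x, continuous u} -> {for x, continuous v}.
Proof.
move=> uv; have uvx : u x = v x := nbhs_singleton uv.
rewrite /prop_for /continuous_at uvx; apply: cvg_trans.
exact: near_eq_cvg.
Qed.

(** Derivatives of [phi \o u] are known only on [Omega]; since [Omega] is open, agreement there is
    agreement near each of its points. *)
Lemma eq_C1_on (u v : 'rV[R]_d -> Y) :
  (forall y, Omega y -> u y = v y) -> C1_on Omega u -> C1_on Omega v.
Proof.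
move=> uv C1u x Ox; have [cu du] := C1u x Ox; split.
  exact: eq_near_continuous (near_open_eq Ox uv) cu.
move=> i; have [dui cdui] := du i; split.
  exact: near_eq_derivable (near_open_eq Ox uv) dui.
apply: eq_near_continuous cdui; apply: near_open_eq Ox _ => y Oy.
exact: near_eq_derive (near_open_eq Oy uv).
Qed.

Lemma derive_linear_comp (u : 'rV[R]_d -> X) i : C1_on Omega u ->
  forall x, Omega x ->
    (phi \o 'D_(unit_vec i) u) x = 'D_(unit_vec i) (phi \o u) x.
Proof.
move=> C1u x Ox; have [_ /(_ i)[du _]] := C1u x Ox.
by rewrite (derivable_linear_comp cphi du).2.
Qed.

Lemma C1_on_linear_comp (u : 'rV[R]_d -> X) :
  C1_on Omega u -> C1_on Omega (phi \o u).
Proof.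
move=> C1u x Ox; have [cu du] := C1u x Ox; split.
  by apply: continuous_comp => //; exact: cphi.
move=> i; have [dui cdui] := du i; split.
  exact: (derivable_linear_comp cphi dui).1.
apply: eq_near_continuous (near_open_eq Ox (derive_linear_comp i C1u)) _.
by apply: continuous_comp => //; exact: cphi.
Qed.

Lemma harmonic_on_linear_comp (u : 'rV[R]_d -> X) :
  harmonic_on Omega u -> harmonic_on Omega (phi \o u).
Proof.
move=> [[C1u C2u] lapu]; split.
  split; first exact: C1_on_linear_comp.
  move=> i; apply: eq_C1_on (derive_linear_comp i C1u) _.
  exact: C1_on_linear_comp.
move=> x Ox; transitivity (phi (laplacian u x)); last by rewrite lapu// linear0.
rewrite /laplacian linear_sum; apply: eq_bigr => i _.
(* First [phi] passes through the outer derivative at [x]; the inner derivatives then agree near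
   [x]. *)
apply/esym/(etrans (derive_linear_comp i (C2u i) Ox))/near_eq_derive.
exact: near_open_eq Ox (derive_linear_comp i C1u).
Qed.

End LinearComp.

Lemma contraction_continuous {R : realType} {X Y : normedModType R}
    {phi : {linear X -> Y}} : (forall x, `|phi x| <= `|x|) -> continuous phi.
Proof.
move=> phi1; apply: bounded_linear_continuous; exists 1; split=> // M M1.
apply: filterS (nbhs0_lt (lt_trans ltr01 M1)) => x /ltW.
exact: le_trans.
Qed.

Lemma bounded_dirichlet_solution_linear_comp {R : realType} {d : nat}
    {X Y : normedModType R} {phi : {linear X -> Y}} {Omega : set 'rV[R]_d}
    {f u : 'rV[R]_d -> X} :
  (forall x, `|phi x| <= `|x|) -> open Omega ->
  bounded_dirichlet_solution Omega f u ->
  bounded_dirichlet_solution Omega (phi \o f) (phi \o u).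
Proof.
move=> phi1 oO [hu bu limu].
have cphi := contraction_continuous phi1.
split; first exact: (harmonic_on_linear_comp cphi oO hu).
  have [M [Mr Mu]] := bu; exists M; split=> // N MN x Ox.
  exact: le_trans (phi1 _) (Mu _ MN x Ox).
by move=> z rz; exact: (cvg_comp _ _ (limu z rz) (cphi _)).
Qed.

(** * Simple functions, weak integrals and Bochner integrals *)

Section BochnerSimple.
Context {d : measure_display} {T : measurableType d} {R : realType}.
Context {mu : {finite_measure set T -> \bar R}} {D : set T}.
Context {X : normedModType R}.
Hypothesis mD : measurable D.
Implicit Types (s f : T -> X).

Lemma bochner_simple_cst (y : X) : bochner_simple D (fun=> y).
Proof.
split; first by apply: (sub_finite_set _ (finite_set1 y)) => _ [x _ <-].
move=> z; have [<-|yz] := pselect (y = z).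
  by rewrite (_ : _ `&` _ = D)//; apply/seteqP; split=> x //= [].
by rewrite (_ : _ `&` _ = set0)//; apply/seteqP; split=> x //= [].
Qed.

(** Overriding a simple function on one set is the inductive step of [bochner_simple_approx]. *)
Lemma bochner_simple_if (P : set T) (y : X) s : measurable (D `&` P) ->
  bochner_simple D s ->
  bochner_simple D (fun x => if x \in P then y else s x).
Proof.
move=> mP [fs ms]; split.
  apply: (@sub_finite_set _ _ (y |` s @` D)); last by rewrite finite_setU.
  by move=> _ [x Dx <-]; case: ifPn => _; [left|right; exists x].
move=> z.
have -> : D `&` (fun x => if x \in P then y else s x) @^-1` [set z] =
    (D `&` P) `&` (fun=> y = z) `|` (D `&` s @^-1` [set z]) `\` (D `&` P).
  apply/seteqP; split=> x /=.
    move=> [Dx]; case: ifPn => [/set_mem Px yz|]; first by left.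
    by move/negP => Px sz; right; split=> // -[_ /mem_set].
  move=> [[[Dx Px] yz]|[[Dx sz] Px]]; split=> //.
    by rewrite mem_set.
  by case: ifPn => // /set_mem Px'; case: Px.
apply: measurableU; last exact: measurableD.
have [yz|yz] := pselect (y = z).
  by rewrite (_ : _ `&` _ = D `&` P)//; apply/seteqP; split=> x //= [].
by rewrite (_ : _ `&` _ = set0)//; apply/seteqP; split=> x //= [].
Qed.

(** On each of the finitely many level sets of [s] the second argument of [F] is constant, so
    measurability in the first one suffices. *)
Lemma bochner_simple_measurable_fun (F : T -> X -> R) s :
  bochner_simple D s -> (forall y, measurable_fun D (F ^~ y)) ->
  measurable_fun D (fun x => F x (s x)).
Proof.
move=> [fs ms] mF _ B mB.
have -> : D `&` (fun x => F x (s x)) @^-1` B =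
    \bigcup_(y in s @` D)
      ((D `&` s @^-1` [set y]) `&` (D `&` (F ^~ y) @^-1` B)).
  apply/seteqP; split=> x /=.
    by move=> [Dx Bx]; exists (s x) => //; exists x.
  by move=> [y _ [[Dx <-] [_ Bx]]].
by apply: fin_bigcup_measurable => // y _; apply: measurableI => //; exact: mF.
Qed.

Lemma bochner_simple_integrable (phi : X -> R) s : bochner_simple D s ->
  mu.-integrable D (EFin \o (phi \o s)).
Proof.
move=> ss; apply: measurable_bounded_integrable => //.
- by rewrite -ge0_fin_numE// fin_num_measure.
- by apply: (@bochner_simple_measurable_fun (fun=> phi)).
have [M phiM] : bounded_set (phi @` (s @` D)).
  exact/(@compact_bounded _ R^o)/finite_compact/finite_image/ss.1.
exists M; split; first exact: phiM.1.
by move=> N MN x Dx; apply: (phiM.2 _ MN); exists (s x) => //; exists x.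
Qed.

Lemma bochner_sintegral_linear (phi : {linear X -> R^o}) s :
  bochner_simple D s ->
  phi (bochner_sintegral mu D s) = (\int[mu]_(x in D) phi (s x))%R :> R.
Proof.
move=> ss; have [fs ms] := ss.
pose A y := D `&` s @^-1` [set y].
(* On [D], [phi \o s] is a finite combination of indicators of level sets; only the term of the
   value [s x] survives at [x]. *)
have sE x : x \in D -> (phi (s x) : R)%:E =
    (\sum_(y <- fset_set (s @` D)) (phi y * \1_(A y) x)%:E)%E.
  move=> /set_mem Dx; have sxD : s x \in fset_set (s @` D).
    by rewrite in_fset_set//; apply/mem_set; exists x.
  rewrite (big_fsetD1 (s x))//= indicE mem_set// mulr1 big_seq big1 ?adde0//.
  move=> y; rewrite in_fsetD1 => /andP[/eqP ysx _].
  by rewrite indicE memNset ?mulr0// => -[_ /esym].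
have mA y : measurable (A y) := ms y.
have iA y : mu.-integrable D (fun x => (\1_(A y) x)%:E).
  exact: integrableS (integrable_indic mu (mA y)).
have intA y : (\int[mu]_(x in D) (phi y * \1_(A y) x)%:E =
    (fine (mu (A y)) * phi y)%:E)%E.
  under eq_integral do rewrite EFinM.
  rewrite integralZl// integral_indic// setIidl; last by move=> x [].
  by rewrite EFinM fineK ?fin_num_measure// muleC.
rewrite /Rintegral (eq_integral _ _ sE) integral_sum//; last first.
  by move=> y; under eq_fun do rewrite EFinM; exact: integrableZl.
under eq_bigr do rewrite intA.
rewrite sumEFin/= /bochner_sintegral fsbig_finite// linear_sum/=.
by apply: eq_bigr => y _; rewrite linearZ_LR.
Qed.

(** A Pettis-type integral tested on linear contractions only; these include the norming
    functionals, which determine [K]. *)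
Definition is_weak_integral f (K : X) : Prop :=
  forall phi : {linear X -> R^o}, (forall x, `|phi x| <= `|x|) ->
    mu.-integrable D (EFin \o (phi \o f)) /\
    phi K = (\int[mu]_(x in D) phi (f x))%R.

(* Testing against a functional norming the difference replaces additivity of
   the integral of simple functions and completeness of [X]. *)
Lemma dist_bochner_sintegral f s (K : X) :
  bochner_simple D s ->
  (forall y, measurable_fun D (fun x => `|f x - y|)) ->
  is_weak_integral f K ->
  (`|bochner_sintegral mu D s - K|%:E <=
    \int[mu]_(x in D) `|f x - s x|%:E)%E.
Proof.
move=> ss mf fK.
have [phi [phi1 phiE]] := norming_functional (bochner_sintegral mu D s - K).
have [iphi phiK] := fK _ phi1.
have iphis : mu.-integrable D (EFin \o (phi \o s)).
  exact: bochner_simple_integrable.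
have ifs : mu.-integrable D (EFin \o (fun x => phi (f x) - phi (s x))).
  exact: (integrableB mD iphi iphis).
(* The norm equals its own absolute value, hence [phi] of the difference in absolute value: a
   difference of two real integrals. *)
rewrite -normr_id -phiE linearB (bochner_sintegral_linear _ ss) phiK distrC.
rewrite -RintegralB// EFin_normr_Rintegral//.
apply: (le_trans (le_abse_integral _ _ _)) => //.
  by case/integrableP : ifs.
apply: ge0_le_integral => //=.
- apply/measurable_EFinP/measurableT_comp => //; apply/measurable_EFinP.
  by case/integrableP : ifs.
- by apply/measurable_EFinP; exact: (bochner_simple_measurable_fun ss mf).
- by move=> x Dx; rewrite lee_fin -linearB.
Qed.

Lemma cvg_bochner_sintegral f (s : nat -> T -> X) (K : X) :
  (forall n, bochner_simple D (s n)) ->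
  (forall y, measurable_fun D (fun x => `|f x - y|)) ->
  is_weak_integral f K ->
  (\int[mu]_(x in D) `|f x - s n x|%:E @[n --> \oo] --> 0)%E ->
  bochner_sintegral mu D (s n) @[n --> \oo] --> K.
Proof.
move=> ss mf fK fs0; apply/subr_cvg0/norm_cvg0P.
apply: (@fine_cvg _ _ _ _ (fun n => `|bochner_sintegral mu D (s n) - K|%:E)).
apply: squeeze_cvge (cvg_cst _) fs0; apply: nearW => n.
by rewrite lee_fin normr_ge0/=; exact: dist_bochner_sintegral.
Qed.

(** Every approximating sequence has integrals tending to the weak integral, so the choice of
    sequence does not affect the limit. *)
Lemma is_bochner_integral_unique f (K I : X) :
  (forall y, measurable_fun D (fun x => `|f x - y|)) ->
  is_weak_integral f K ->
  is_bochner_integral mu D f I -> I = K.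
Proof.
move=> mf fK [s [ss _ fs0 sI]].
have sK := cvg_bochner_sintegral ss mf fK fs0.
exact: (cvg_unique (@norm_hausdorff _ _) sI sK).
Qed.

(** Induction on the centres: [s] takes the value [y] where [f] is within [e] of the new centre [y],
    and keeps its old value elsewhere. The starting value 0 is harmless, as no point is near an
    empty list. *)
Lemma bochner_simple_approx f (e : R) (c : seq X) :
  (forall y, measurable_fun D (fun x => `|f x - y|)) ->
  exists2 s, bochner_simple D s &
    forall x, (exists2 y, y \in c & `|f x - y| < e) -> `|f x - s x| < e.
Proof.
move=> mf; elim: c => [|y c [s ss fs]].
  by exists (fun=> 0); [exact: bochner_simple_cst|move=> x []].
exists (fun x => if x \in [set x | `|f x - y| < e] then y else s x).
  apply: bochner_simple_if => //.
  have := mf y mD `]-oo, e[%classic (measurable_itv _).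
  by congr (measurable _); apply/seteqP; split=> x /=; rewrite in_itv.
move=> x [z]; rewrite inE => /predU1P[-> fxy|zc fxz].
  by case: ifPn => //; rewrite notin_setE.
by case: ifPn => [/set_mem//|_]; apply: fs; exists z.
Qed.

(** A finite net of the compact image, of mesh [n.+1%:R^-1], gives a simple function uniformly that
    close to [f] on [D]; as [mu D] is finite, the integrals of the errors tend to 0. *)
Lemma compact_is_bochner_integral f (K : X) :
  (forall y, measurable_fun D (fun x => `|f x - y|)) ->
  is_weak_integral f K ->
  compact (f @` D) ->
  is_bochner_integral mu D f K.
Proof.
move=> mf fK cfD.
have /choice[s sP] (n : nat) : exists s, bochner_simple D s /\
    forall x, D x -> `|f x - s x| < n.+1%:R^-1.
  move: cfD; rewrite compact_cover => cfD.
  have n0 : 0 < n.+1%:R^-1 :> R by rewrite invr_gt0.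
  have [||c _ fDc] := cfD X (f @` D) (fun y => ball y n.+1%:R^-1).
  - by move=> y _; exact: ball_open.
  - by move=> _ [x Dx <-]; exists (f x); [exists x|exact: ballxx].
  have [s ss fs] := bochner_simple_approx n.+1%:R^-1 c mf.
  exists s; split=> // x Dx; apply: fs.
  have [|y /= yc] := fDc (f x); first by exists x.
  by rewrite -ball_normE/= distrC; exists y.
have fs0 : (\int[mu]_(x in D) `|f x - s n x|%:E @[n --> \oo] --> 0)%E.
  have muD : mu D \is a fin_num by exact: fin_num_measure.
  apply: (@squeeze_cvge _ _ _ _ (fun=> 0%E) _
    (fun n => (n.+1%:R^-1 * fine (mu D))%:E)); first last.
  - apply: cvg_EFin; first exact: nearW.
    have := @cvgMr_tmp _ _ _ _ _ _ (fine (mu D)) (@cvg_harmonic R).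
    rewrite mul0r; exact.
  - exact: cvg_cst.
  apply: nearW => n; rewrite integral_ge0//= EFinM fineK//.
  rewrite -integral_cst//; apply: ge0_le_integral => //=.
  - apply/measurable_EFinP.
    exact: (bochner_simple_measurable_fun (sP n).1 mf).
  - by move=> x Dx; rewrite lee_fin ltW// (sP n).2.
exists s; split=> //.
- by move=> n; exact: (sP n).1.
- apply: aeW => x Dx; apply/cvgrPdist_lt => e e0.
  have := @near_infty_natSinv_lt R (PosNum e0).
  by apply: filterS => n; apply: lt_trans; exact: (sP n).2.
- by apply: cvg_bochner_sintegral => // n; exact: (sP n).1.
Qed.

End BochnerSimple.

(** * Borel sets, the compact boundary and the representation formula *)

Lemma open_measurable_borelRn {R : realType} {d : nat} (U : set 'rV[R]_d) :
  open U -> measurable (U : set (borelRn R d)).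
Proof. by move=> oU; exact: sub_sigma_algebra. Qed.

Lemma closed_measurable_borelRn {R : realType} {d : nat} (D : set 'rV[R]_d) :
  closed D -> measurable (D : set (borelRn R d)).
Proof.
move=> cD; rewrite -[D]setCK; apply: measurableC.
by apply: open_measurable_borelRn; exact: closed_openC.
Qed.

Lemma continuous_measurable_borelRn {R : realType} {d : nat}
    (D : set 'rV[R]_d) (g : 'rV[R]_d -> R) : closed D ->
  {within D, continuous g} ->
  measurable_fun (D : set (borelRn R d)) (g : borelRn R d -> R).
Proof.
move=> cD /continuousP cg; apply: (measurability _ (RGenOpens.measurableE R)).
move=> _ [_ [a [b ->] <-]].
have oab : open `]a, b[%classic by exact: interval_open.
(* The preimage of an open interval is relatively open: inside [D] it is the trace of an open set
   [V]. *)
have /open_subspaceP[V oV VD] := cg _ oab.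
rewrite setIC -VD; apply: measurableI.
  exact: open_measurable_borelRn.
exact: closed_measurable_borelRn.
Qed.

Lemma boundary_compact {R : realType} {d : nat} (Omega : set 'rV[R]_d) :
  bounded_set Omega -> compact (boundary Omega) /\ closed (boundary Omega).
Proof.
move=> bO; have cD : closed (boundary Omega).
  rewrite /boundary setDE; apply: closedI; first exact: closed_closure.
  by apply: open_closedC; exact: open_interior.
split=> //; apply: bounded_closed_compact => //.
have [M [Mr OM]] := bO; exists M; split=> // N MN x [clx _].
(* A closed ball containing [Omega] also contains its closure. *)
have cN : closed [set y : 'rV[R]_d | `|y| <= N].
  apply: (@preimage_closed _ _ (fun y : 'rV[R]_d => `|y|) [set r | r <= N]).
    by move=> y _; exact: norm_continuous.
  exact: closed_le.
have : closure [set y : 'rV[R]_d | `|y| <= N] x.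
  by apply: closureS clx => y Oy; exact: OM.
by move/closure_id : cN => <-.
Qed.

Theorem corollary1p9 (R : realType) (d : nat) (Omega : set 'rV[R]_d)
  (X : completeNormedModType R) (f Hf : 'rV[R]_d -> X)
  (mu : 'rV[R]_d -> probability (borelRn R d) R) :
  open Omega ->
  bounded_set Omega ->
  {within boundary Omega, continuous f} ->
  is_perron_solution Omega f Hf ->
  (forall xi, Omega xi -> is_harmonic_measure Omega xi (mu xi)) ->
  forall xi, Omega xi ->
    bochner_integrable (mu xi) (boundary Omega) f /\
    Hf xi = bochner_integral (mu xi) (boundary Omega) f.
Proof.
move=> oO bO cf [solf _] hmu xi Oxi.
have [cptD cD] := boundary_compact bO.
have mD := closed_measurable_borelRn cD.
have cptfD := continuous_compact cf cptD.
have cfy y : {within boundary Omega, continuous (fun x => f x - y)}.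
  by move=> x; apply: cvgB; [exact: cf|exact: cvg_cst].
have mf y : measurable_fun (boundary Omega : set (borelRn R d))
    (fun x => `|f x - y|).
  apply: continuous_measurable_borelRn => // x.
  by apply: cvg_norm; exact: cfy.
have fK : is_weak_integral (mu := mu xi) (D := boundary Omega) f (Hf xi).
  move=> phi phi1; have cphi := contraction_continuous phi1.
  have cphif : {within boundary Omega, continuous (phi \o f)}.
    by move=> x; exact: (cvg_comp _ _ (cf x) (cphi _)).
  split.
    apply: measurable_bounded_integrable => //.
    - by rewrite -ge0_fin_numE// fin_num_measure.
    - exact: continuous_measurable_borelRn.
    have [M [Mr fM]] := compact_bounded cptfD; exists M; split=> // N MN x Dx.
    by apply: le_trans (phi1 _) _; apply: (fM _ MN); exists x.
  (* The integral of [phi \o f] is the value at [xi] of its real Perron solution [Hg], and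
     uniqueness identifies [phi \o Hf] with [Hg] on [Omega]. *)
  have [Hg [[_ Hg_uniq] <-]] := (hmu xi Oxi).2 _ cphif.
  have solphi := bounded_dirichlet_solution_linear_comp phi1 oO solf.
  exact: Hg_uniq solphi _ Oxi.
have int_f : is_bochner_integral (mu xi) (boundary Omega) f (Hf xi).
  exact: (compact_is_bochner_integral mD mf fK cptfD).
split; first by exists (Hf xi).
(* [bochner_integral] picks some integral, with default 0; existence rules out the default case and
   uniqueness makes the pick [Hf xi]. *)
apply/esym/(is_bochner_integral_unique mD mf fK).
by apply: xgetPex; exists (Hf xi).
Qed.
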